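(* Let $d \geq 2$ and let $G$ be a finitely generated subgroup of the group $\mathcal{D}(\mathcal{T}_d)$ of bounded automaton automorphisms of the $d$-regular rooted tree $\mathcal{T}_d$ (i.e. $G$ is a finitely generated bounded automata group). Then $G$ is co-ET0L.
   Context: **Tree automorphisms.** For $d\ge 2$, $\mathcal{T}_d$ is the infinite rooted tree in which each vertex has exactly $d$ children. Its vertices are identified with the words in $\Sigma^\star$, where $\Sigma=\{a_1,\dots,a_d\}$: the root is the empty word $\varepsilon$ and the $k$-th child of $v$ is $va_k$. $\mathrm{Aut}(\mathcal{T}_d)$ is the group of automorphisms of this rooted tree. Each $\alpha\in \mathrm{Aut}(\mathcal{T}_d)$ is written uniquely as $\alpha=(\alpha_1,\dots,\alpha_d)\cdot\sigma\in \mathrm{Aut}(\mathcal{T}_d)\wr\mathrm{Sym}(\Sigma)$, where $\sigma$ is the permutation of the first level and $\alpha_i\in\mathrm{Aut}(\mathcal{T}_d)$ is the action on the sub-tree with root $a_i$; the restriction of $\alpha$ to $a_i$ is $\alpha|_{a_i}:=\alpha_i$ (so $\alpha(a_iw)=\sigma(a_i)\,\alpha_i(w)$ for $w\in\Sigma^\star$). For $w=w_1\cdots w_k\in\Sigma^\star$ the restriction is defined recursively by $\alpha|_w=(\alpha|_{w_1\cdots w_{k-1}})|_{w_k}$, with $\alpha|_\varepsilon=\alpha$. **Automaton automorphisms.** A $\Sigma$-automaton $(\Gamma,v)$ is a finite directed graph $\Gamma$ with a distinguished vertex $v$ (the initial state) and a $(\Sigma\times\Sigma)$-labelling of its edges such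 that each vertex has exactly $|\Sigma|$ outgoing edges, with, for each $a\in\Sigma$, one outgoing edge with label of the form $(a,\cdot)$ and one outgoing edge with label of the form $(\cdot,a)$. It defines $\alpha_{(\Gamma,v)}\in\mathrm{Aut}(\mathcal{T}_d)$ by $\alpha_{(\Gamma,v)}(b_1\cdots b_k)=b_1'\cdots b_k'$, where $(b_1,b_1')(b_2,b_2')\cdots(b_k,b_k')$ is the label of the unique path of this form in $\Gamma$ starting at $v$. An automaton automorphism is an element of $\mathrm{Aut}(\mathcal{T}_d)$ equal to $\alpha_{(\Gamma,v)}$ for some $\Sigma$-automaton $(\Gamma,v)$; these form a group $\mathcal{A}(\mathcal{T}_d)$. **Bounded automata groups.** $\alpha\in\mathrm{Aut}(\mathcal{T}_d)$ is bounded if there is a constant $N\in\mathbb{N}$ such that for each $k\in\mathbb{N}$ there are no more than $N$ vertices $v\in\Sigma^\star$ with $|v|=k$ and $\alpha|_v\ne 1$. The bounded automorphisms form a group $\mathcal{B}(\mathcal{T}_d)$. Put $\mathcal{D}(\mathcal{T}_d)=\mathcal{A}(\mathcal{T}_d)\cap\mathcal{B}(\mathcal{T}_d)$. A bounded automata group is a subgroup of $\mathcal{D}(\mathcal{T}_d)$. **ET0L languages.** Let $\Sigma$ (terminals) and $V$ (non-terminals) be finite alphabets (here $\Sigma$ is an arbitrary finite alphabet, unrelated to the tree alphabet). A table $\tau$ is a finite set of context-free replacement rules $X\to u$ with $X\in V$, $u\in(\Sigma\cup V)^\star$, such that each $X\in V$ has at least one replacement in $\tau$. For $w,w'\in(\Sigma\cup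 V)^\star$, write $w\to^\tau w'$ if $w'$ is obtained from $w$ by performing a replacement from $\tau$ on every occurrence of a non-terminal in $w$ (different occurrences of the same non-terminal may use different rules of $\tau$; other letters are unchanged). For a sequence of tables, $w\to^{\tau_1\tau_2\cdots\tau_k}w'$ means there are words $w=w_1,w_2,\dots,w_{k+1}=w'$ with $w_j\to^{\tau_j}w_{j+1}$ for each $j$. An ET0L grammar is a tuple $(\Sigma,V,T,\mathcal{R},S)$ with $\Sigma$ a finite alphabet of terminals, $V$ a finite alphabet of non-terminals, $T$ a finite set of tables, $\mathcal{R}\subseteq T^\star$ a regular language (the rational control), and $S\in V$ the start symbol. The language it produces is $\{w\in\Sigma^\star : S\to^v w\text{ for some }v\in\mathcal{R}\}$. A language is ET0L if it is produced by some ET0L grammar. **Co-ET0L groups.** For a group $G$ with finite generating set $X$, the co-word problem $\mathrm{coW}(G,X)$ is the set of all words in $(X\cup X^{-1})^\star$ that represent non-trivial elements of $G$. A finitely generated group $G$ is co-ET0L if $\mathrm{coW}(G,X)$ is an ET0L language for a finite generating set $X$ of $G$; because the class of ET0L languages is closed under inverse homomorphism, this does not depend on the choice of finite generating set $X$. *)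

(* Defs.v *)
From HB Require Import structures.
From mathcomp Require Import all_boot finmap.
From mathcomp Require Import boolp classical_sets.

Set Implicit Arguments.
Unset Strict Implicit.
Unset Printing Implicit Defensive.

Local Open Scope classical_set_scope.

Section TreeAutomorphisms.
Variable d : nat.

Definition tree_adj (u v : seq 'I_d) : Prop :=
  exists a : 'I_d, v = rcons u a \/ u = rcons v a.

Record tree_aut : Type := TreeAut {
  tree_aut_fun :> seq 'I_d -> seq 'I_d;
  tree_aut_bij : bijective tree_aut_fun;
  tree_aut_root : tree_aut_fun [::] = [::];
  tree_aut_adj : forall u v,
    tree_adj (tree_aut_fun u) (tree_aut_fun v) <-> tree_adj u v }.

HB.instance Definition _ := gen_eqMixin tree_aut.
HB.instance Definition _ := gen_choiceMixin tree_aut.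

Lemma tree_aut_ext (f g : tree_aut) : f =1 g -> f = g.
Proof.
case: f g => [f bf rf af] [g bg rg ag] /= /funext efg; subst g.
by congr TreeAut; apply: Prop_irrelevance.
Qed.

Lemma tree_aut_one_adj (u v : seq 'I_d) : tree_adj (id u) (id v) <-> tree_adj u v.
Proof. by []. Qed.

Definition tree_aut_one : tree_aut :=
  TreeAut (Bijective (frefl _) (frefl _)) (erefl [::]) tree_aut_one_adj.

Section Mul.
Variables f g : tree_aut.

Lemma tree_aut_mul_root : (g \o f) [::] = [::].
Proof. by rewrite /= !tree_aut_root. Qed.

Lemma tree_aut_mul_adj u v : tree_adj ((g \o f) u) ((g \o f) v) <-> tree_adj u v.
Proof. exact: iff_trans (tree_aut_adj g _ _) (tree_aut_adj f _ _). Qed.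

(* Products are read from left to right, as for the permutations of perm.v, so
   that the wreath decomposition alpha = (alpha_1, ..., alpha_d) . sigma means
   alpha (a_i :: w) = sigma a_i :: alpha_i w. *)
Definition tree_aut_mul : tree_aut :=
  TreeAut (bij_comp (tree_aut_bij g) (tree_aut_bij f))
    tree_aut_mul_root tree_aut_mul_adj.

End Mul.

Section Inv.
Variable f : tree_aut.

Lemma tree_aut_inv_subproof : exists g, cancel f g /\ cancel g f.
Proof. by have [g fK gK] := tree_aut_bij f; exists g. Qed.

Definition tree_aut_inv_fun : seq 'I_d -> seq 'I_d := sval (cid tree_aut_inv_subproof).

Lemma tree_aut_invK : cancel f tree_aut_inv_fun.
Proof. by rewrite /tree_aut_inv_fun; case: cid => g []. Qed.

Lemma tree_aut_invKV : cancel tree_aut_inv_fun f.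
Proof. by rewrite /tree_aut_inv_fun; case: cid => g []. Qed.

Lemma tree_aut_inv_root : tree_aut_inv_fun [::] = [::].
Proof. by rewrite -[X in tree_aut_inv_fun X](tree_aut_root f) tree_aut_invK. Qed.

Lemma tree_aut_inv_adj u v :
  tree_adj (tree_aut_inv_fun u) (tree_aut_inv_fun v) <-> tree_adj u v.
Proof. by have := tree_aut_adj f (tree_aut_inv_fun u) (tree_aut_inv_fun v); rewrite !tree_aut_invKV => -[]. Qed.

Definition tree_aut_inv : tree_aut :=
  TreeAut (Bijective tree_aut_invKV tree_aut_invK)
    tree_aut_inv_root tree_aut_inv_adj.

End Inv.

Lemma tree_aut_mulA : associative tree_aut_mul.
Proof. by move=> f g h; apply: tree_aut_ext. Qed.

Lemma tree_aut_mul1 : left_id tree_aut_one tree_aut_mul.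
Proof. by move=> f; apply: tree_aut_ext. Qed.

Lemma tree_aut_mulr1 : right_id tree_aut_one tree_aut_mul.
Proof. by move=> f; apply: tree_aut_ext. Qed.

Lemma tree_aut_mulV : left_inverse tree_aut_one tree_aut_inv tree_aut_mul.
Proof. by move=> f; apply: tree_aut_ext => w /=; rewrite tree_aut_invKV. Qed.

Lemma tree_aut_mulrV : right_inverse tree_aut_one tree_aut_inv tree_aut_mul.
Proof. by move=> f; apply: tree_aut_ext => w /=; rewrite tree_aut_invK. Qed.

HB.instance Definition _ := isGroup.Build tree_aut
  tree_aut_mulA tree_aut_mul1 tree_aut_mulr1 tree_aut_mulV tree_aut_mulrV.

Section Restriction.
Variables (f : tree_aut) (a : 'I_d).

Definition first_letter : 'I_d := head a (f [:: a]).
Definition restr1_fun (w : seq 'I_d) : seq 'I_d := behead (f (a :: w)).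

Lemma tree_aut_rcons (v : seq 'I_d) (b : 'I_d) :
  exists c, f (rcons v b) = rcons (f v) c.
Proof.
elim/last_ind: v b => [b|v c IHv b].
  have /(tree_aut_adj f)[x []] : tree_adj [::] [:: b] by exists b; left.
    by rewrite tree_aut_root => ->; exists x.
  by rewrite tree_aut_root; case: (f _).
have /(tree_aut_adj f)[x [->|]] : tree_adj (rcons v c) (rcons (rcons v c) b).
- by exists b; left.
- by exists x.
have [y ->] := IHv c => /rcons_inj[+ _].
move=> /(bij_inj (tree_aut_bij f)) /(congr1 size).
by rewrite !size_rcons => /eqP; rewrite -addn2 -[X in X == _]addn0 eqn_add2l.
Qed.

Lemma tree_aut_cons (w : seq 'I_d) :
  f (a :: w) = first_letter :: restr1_fun w.
Proof.
rewrite /restr1_fun /first_letter; elim/last_ind: w => [|w b IHw].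
  have [c] := tree_aut_rcons [::] a.
  by rewrite tree_aut_root /= => ->.
rewrite -rcons_cons; have [c ->] := tree_aut_rcons (a :: w) b.
by rewrite IHw.
Qed.

End Restriction.

Section RestrictionAut.
Variables (f : tree_aut) (a : 'I_d).

Lemma restr1_bij : bijective (restr1_fun f a).
Proof.
have [g fK gK] := tree_aut_bij f.
exists (fun w => behead (g (first_letter f a :: w))) => w.
  by rewrite -tree_aut_cons fK.
rewrite /restr1_fun; set u := g _.
have fu : f u = first_letter f a :: w by rewrite /u gK.
case: u fu => [|b u]; first by rewrite tree_aut_root.
rewrite tree_aut_cons => -[eba eu] /=.
suff <- : b = a by [].
suff /(bij_inj (tree_aut_bij f))[] : f [:: b] = f [:: a] by [].
have nilE c : restr1_fun f c [::] = [::].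
  have [x] := tree_aut_rcons f [::] c.
  by rewrite tree_aut_root /restr1_fun /= => ->.
by rewrite !tree_aut_cons eba !nilE.
Qed.

Lemma restr1_root : restr1_fun f a [::] = [::].
Proof.
have [x] := tree_aut_rcons f [::] a.
by rewrite tree_aut_root /restr1_fun /= => ->.
Qed.

Lemma tree_adj_cons b (u v : seq 'I_d) :
  tree_adj (b :: u) (b :: v) <-> tree_adj u v.
Proof.
by split=> -[x E]; exists x; move: E => /=;
  [case=> -[->]; [left|right] | case=> ->; [left|right]].
Qed.

Lemma restr1_adj u v :
  tree_adj (restr1_fun f a u) (restr1_fun f a v) <-> tree_adj u v.
Proof.
apply: iff_trans (iff_sym (tree_adj_cons (first_letter f a) _ _)) _.
rewrite -!tree_aut_cons.
exact: iff_trans (tree_aut_adj f _ _) (tree_adj_cons a u v).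
Qed.

Definition restr1 : tree_aut := TreeAut restr1_bij restr1_root restr1_adj.

End RestrictionAut.

Definition restr (f : tree_aut) (w : seq 'I_d) : tree_aut := foldl restr1 f w.

Definition bounded_aut : set tree_aut :=
  [set f | exists N : nat, forall k : nat,
    (#|[set v : k.-tuple 'I_d | restr f v != 1%g]%SET| <= N)%N].

End TreeAutomorphisms.

(* Multiple edges between the same two states are allowed. *)
Record automaton (S : finType) : Type := Automaton {
  state : finType;
  edge : finType;
  source : edge -> state;
  target : edge -> state;
  label : edge -> S * S;
  initial : state;
  automaton_out : forall q : state,
    #|[set e | source e == q]%SET| = #|S|;
  automaton_in_label : forall (q : state) (a : S),
    #|[set e | (source e == q) && ((label e).1 == a)]%SET| = 1;
  automaton_out_label : forall (q : state) (a : S),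
    #|[set e | (source e == q) && ((label e).2 == a)]%SET| = 1 }.

Fixpoint walk (S : finType) (M : automaton S) (q : state M)
    (p : seq (edge M)) : bool :=
  if p is e :: p' then (source e == q) && walk (target e) p' else true.

(* Each input word labels exactly one walk from a given state, by
   [automaton_in_label], so this determines f. *)
Definition defines_aut d (M : automaton 'I_d) (f : tree_aut d) : Prop :=
  forall w : seq 'I_d, exists2 p : seq (edge M), walk (initial M) p &
    unzip1 (map (@label _ M) p) = w /\ unzip2 (map (@label _ M) p) = f w.

Definition automaton_aut d : set (tree_aut d) :=
  [set f | exists M : automaton 'I_d, defines_aut M f].

Definition bounded_automaton_aut d : set (tree_aut d) :=
  @automaton_aut d `&` @bounded_aut d.

Definition regular (A : finType) (L : set (seq A)) : Prop :=
  exists (Q : finType) (q0 : Q) (F : {set Q}) (delta : Q -> A -> Q),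
    L = [set w | foldl delta q0 w \in F].

Section ET0L.
Local Open Scope fset_scope.

Section Rewriting.
Variables S V : finType.

(* Terminals are the [inl] letters, non-terminals the [inr] letters. *)
Definition table : Type := {fset V * seq (S + V)}.

HB.instance Definition _ := Choice.on table.

Inductive rewrites (t : table) : seq (S + V) -> seq (S + V) -> Prop :=
| RewritesNil : rewrites t [::] [::]
| RewritesTerminal a w w' :
    rewrites t w w' -> rewrites t (inl a :: w) (inl a :: w')
| RewritesNonterminal X u w w' :
    (X, u) \in t -> rewrites t w w' -> rewrites t (inr X :: w) (u ++ w').

Fixpoint derives (ts : seq table) (w w' : seq (S + V)) : Prop :=
  if ts is t :: ts' then exists2 w1, rewrites t w w1 & derives ts' w1 w'
  else w = w'.

End Rewriting.

Record ET0L_grammar (S : finType) : Type := ET0LGrammar {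
  nonterminal : finType;
  tables : {fset table S nonterminal};
  tables_total : forall t, t \in tables ->
    forall X : nonterminal, exists u, (X, u) \in t;
  control : set (seq tables);
  control_regular : regular control;
  start : nonterminal }.

Definition ET0L_language (S : finType) (g : ET0L_grammar S) : set (seq S) :=
  [set w | exists2 v : seq (tables g), control v &
     derives (map val v) [:: inr (start g)] (map inl w)].

Definition ET0L (S : finType) (L : set (seq S)) : Prop :=
  exists g : ET0L_grammar S, L = ET0L_language g.

Section CoET0L.
Local Open Scope group_scope.
Variable gT : groupType.

(* The alphabet is the subset of the group made of X and its inverses, not a set
   of formal letters. *)
Definition letters (X : {fset gT}) : {fset gT} := X `|` [fset x^-1 | x in X].

Definition word_value (X : {fset gT}) (w : seq (letters X)) : gT :=
  \prod_(x <- w) val x.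

Definition generates (X : {fset gT}) (G : set gT) : Prop :=
  G = [set g | exists w : seq (letters X), word_value w = g].

Definition finitely_generated (G : set gT) : Prop :=
  exists X : {fset gT}, generates X G.

Definition coword_problem (X : {fset gT}) : set (seq (letters X)) :=
  [set w | word_value w != 1].

Definition co_ET0L (G : set gT) : Prop :=
  exists2 X : {fset gT}, generates X G & ET0L (@coword_problem X).

End CoET0L.
End ET0L.

(* Main.v *)
From HB Require Import structures.
Require Import Defs.
From mathcomp Require Import all_boot finmap.
From mathcomp Require Import boolp classical_sets.

Set Implicit Arguments.
Unset Strict Implicit.
Unset Printing Implicit Defensive.

(** Let w = x_1 ... x_n be a word in the generators and their inverses. It is
    nontrivial exactly when it fixes some vertex u and moves a child of u
    ([moved_child]). Follow u through the word: u_0 = u and u_i = x_i (u_(i-1)).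
    Call a letter x active at a vertex v when the restriction of x to v is
    nontrivial. Boundedness says that, for some N, every level of the tree has
    at most N vertices at which some letter is active. Cut w at the positions i
    where x_i is active at the prefix of length k of u_(i-1). The factors
    between two cuts change that prefix but leave the rest of the vertex alone,
    and the end points of a factor, apart from the two ends of w, are among
    those N vertices, since an active letter x at v makes its inverse active at
    x(v). Passing from k to k - 1 cuts each factor further; the letters at the
    new cuts only read a letter of the tree alphabet and the restriction of a
    generator, of which there are finitely many because generators are
    automaton automorphisms ([automaton_restr_finite]). At the root nothing but
    letters that are trivial in the group is left.

    An ET0L grammar can run this refinement from the level of u up to the root.
    A nonterminal [Segment t i j] stands for a factor that carries the i-th
    named vertex of the current level to the j-th one and none of whose letters
    is active on the way; t is a finite description of the level, giving the
    restrictions of the letters to the named vertices, the images of these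
    vertices and their parents. The grammar guesses the description of the next
    level. All the factors must rely on the same guess, and this is what the
    tables are for: apart from a table that does the cutting, there is one table
    for each possible description, applied to the whole sentential form at once.
    The rules check that consecutive descriptions fit together, so that all
    sequences of tables can be allowed.

    [yields_meaning] shows that derivable words are nontrivial: the sequence of
    tables determines a vertex for each name, for which the descriptions are
    true. [yields_start] shows conversely that each nontrivial word is
    derivable, from the true descriptions of the levels above u. *)

(** * Tree automorphisms and their restrictions *)

Section TreeAut.
Variable d : nat.
Implicit Types (f g : tree_aut d) (u v w : seq 'I_d).

Lemma tree_aut1E u : (1%g : tree_aut d) u = u.
Proof. by []. Qed.

Lemma tree_aut_cat f u w : f (u ++ w) = f u ++ restr f u w.
Proof.
elim: u f => [|a u IHu] f; first by rewrite tree_aut_root.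
rewrite cat_cons !tree_aut_cons cat_cons.
by rewrite -[restr1_fun f a]/(tree_aut_fun (restr1 f a)) IHu.
Qed.

Lemma tree_aut_rconsE f u a :
  f (rcons u a) = rcons (f u) (first_letter (restr f u) a).
Proof. by rewrite -cats1 tree_aut_cat tree_aut_cons restr1_root cats1. Qed.

Lemma size_tree_aut f u : size (f u) = size u.
Proof.
elim/last_ind: u => [|u a IHu]; first by rewrite tree_aut_root.
by rewrite tree_aut_rconsE !size_rcons IHu.
Qed.

Lemma restr_rcons f u a : restr f (rcons u a) = restr1 (restr f u) a.
Proof. exact: foldl_rcons. Qed.

Lemma restr1_one a : restr1 1%g a = 1%g :> tree_aut d.
Proof. exact: tree_aut_ext. Qed.

(** For a symmetric alphabet, this closes the set of vertices at which some
    letter is active under the letters active there. If the inverse of f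
    carries the subtree below f(u) onto the one below u without changing it
    otherwise, then f carries it back in the same way. *)
Lemma restr_inv_eq1 f u : restr f^-1%g (f u) = 1%g -> restr f u = 1%g.
Proof.
move=> fV1; apply: tree_aut_ext => w; rewrite tree_aut1E.
have := tree_aut_cat f^-1%g (f u) w; rewrite fV1 tree_aut1E.
rewrite -[f^-1%g (_ ++ _)]/(tree_aut_inv_fun f _).
rewrite -[f^-1%g (f u)]/(tree_aut_inv_fun f _).
rewrite tree_aut_invK => /(congr1 f).
by rewrite tree_aut_invKV tree_aut_cat => /eqP; rewrite eqseq_cat // eqxx => /eqP.
Qed.

(** Take a shortest moved vertex: its parent is fixed. *)
Lemma moved_child f :
  f != 1%g -> exists u a b, [/\ f u = u, f (rcons u a) = rcons u b & a != b].
Proof.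
move=> f_neq1; have [v] : exists v, f v != v.
  apply: contrapT => fix_f; case/eqP: f_neq1; apply: tree_aut_ext => v.
  by apply/eqP; apply: contrapT => /negP fv; apply: fix_f; exists v.
elim/last_ind: v => [|u a IHu]; first by rewrite tree_aut_root eqxx.
rewrite tree_aut_rconsE; have [fu|] := eqVneq (f u) u; last by move/IHu.
rewrite fu => neq; exists u, a, (first_letter (restr f u) a).
by rewrite tree_aut_rconsE fu; split=> //; apply: contraNneq neq => <-.
Qed.

End TreeAut.

(** * Automaton automorphisms have finitely many restrictions *)

Section AutomatonRestrictions.
Variable d : nat.
Implicit Types (f g : tree_aut d).

Definition defines_from (M : automaton 'I_d) (q : state M) f : Prop :=
  forall w : seq 'I_d, exists2 p : seq (edge M), walk q p &
    unzip1 (map (@label _ M) p) = w /\ unzip2 (map (@label _ M) p) = f w.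

Lemma walk_inj (M : automaton 'I_d) (q : state M) p1 p2 :
    walk q p1 -> walk q p2 ->
    unzip1 (map (@label _ M) p1) = unzip1 (map (@label _ M) p2) -> p1 = p2.
Proof.
elim: p1 p2 q => [|e1 p1 IHp] [|e2 p2] q //=.
move=> /andP[/eqP s1 w1] /andP[/eqP s2 w2] [el ep].
suff e12 : e1 = e2.
  by rewrite e12 in w1 *; rewrite (IHp _ _ w1 w2).
have /eqP/cards1P[e eE] := automaton_in_label q (label e1).1.
have: e1 \in [set e] by rewrite -eE inE s1 !eqxx.
have: e2 \in [set e] by rewrite -eE inE s2 el !eqxx.
by rewrite !inE => /eqP-> /eqP->.
Qed.

Lemma defines_from_inj (M : automaton 'I_d) (q : state M) f g :
  defines_from q f -> defines_from q g -> f = g.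
Proof.
move=> qf qg; apply: tree_aut_ext => w.
have [p1 w1 [i1 <-]] := qf w; have [p2 w2 [i2 <-]] := qg w.
by rewrite (walk_inj w1 w2) // i1.
Qed.

Lemma defines_from_restr1 (M : automaton 'I_d) (q : state M) f a :
  defines_from q f -> exists q' : state M, defines_from q' (restr1 f a).
Proof.
move=> qf; have [[|e p]] := qf [:: a]; first by move=> _ [].
move=> /= /andP[/eqP se _] [[ea _] _].
exists (target e) => w; have [[|e' p']] := qf (a :: w); first by move=> _ [].
move=> /= /andP[/eqP se' walk'] [[e'a <-]].
rewrite tree_aut_cons => -[_ out]; exists p'; last by [].
have /eqP/cards1P[e0 eE] := automaton_in_label q a.
have: e \in [set e0] by rewrite -eE inE se ea !eqxx.
have: e' \in [set e0] by rewrite -eE inE se' e'a !eqxx.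
by rewrite !inE => /eqP e'E /eqP->; rewrite -e'E.
Qed.

(** Reading w from the initial state leads to a state that defines the
    restriction to w, and a state defines at most one automorphism. *)
Lemma automaton_restr_finite f : automaton_aut f ->
  exists Q : {fset tree_aut d}, forall w, restr f w \in Q.
Proof.
case=> M Mf.
pose aut_of (q : state M) : tree_aut d :=
  xget 1%g [set g | defines_from q g]%classic.
exists [fset aut_of q | q in [set: state M]]%fset => w.
have [q qfw] : exists q : state M, defines_from q (restr f w).
  elim/last_ind: w => [|w a [q qf]]; first by exists (initial M).
  by rewrite restr_rcons; apply: defines_from_restr1 qf.
apply/imfsetP; exists q; rewrite ?inE //.
by apply: (defines_from_inj qfw); rewrite /aut_of; case: xgetP => // /(_ _ qfw).
Qed.

End AutomatonRestrictions.

(** * ET0L grammars from families of rules *)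

Section RuleFamilies.
Variables (S V K : finType) (R : K -> V -> seq (S + V) -> Prop).

(** Derivation of a terminal word, in big-step form: in the third constructor
    the word r that replaces X continues with the remaining tables ks, in
    parallel with the rest u of the sentential form, on which table k is still
    to act. *)
Inductive yields : seq K -> seq (S + V) -> seq S -> Prop :=
| YieldsNil ks : yields ks [::] [::]
| YieldsTerminal ks a u w : yields ks u w -> yields ks (inl a :: u) (a :: w)
| YieldsNonterminal k ks X r u w1 w2 : R k X r -> yields ks r w1 ->
    yields (k :: ks) u w2 -> yields (k :: ks) (inr X :: u) (w1 ++ w2).

Lemma yields_cat ks u1 u2 w1 w2 :
  yields ks u1 w1 -> yields ks u2 w2 -> yields ks (u1 ++ u2) (w1 ++ w2).
Proof.
elim=> {ks u1 w1} [ks|ks a u w _ IHu|k ks X r u w1 w1' Rr yr _ _ IHu] y2 //=.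
  by constructor; apply: IHu.
by rewrite -catA; apply: YieldsNonterminal Rr yr (IHu y2).
Qed.

Lemma yields_cat_inv ks u1 u2 w : yields ks (u1 ++ u2) w ->
  exists w1 w2, [/\ w = w1 ++ w2, yields ks u1 w1 & yields ks u2 w2].
Proof.
elim: u1 w => [|x u1 IHu] w /=.
  by exists [::], w; split=> //; constructor.
move=> y; inversion y as [|? a ? w' y'|k ks' X r ? w1 w2 Rr yr y']; subst.
  have [w1 [w2 [-> y1 y2]]] := IHu _ y'.
  by exists (a :: w1), w2; split=> //; constructor.
have [w3 [w4 [-> y3 y4]]] := IHu _ y'.
by exists (w1 ++ w3), w4; rewrite catA; split=> //; apply: YieldsNonterminal Rr yr y3.
Qed.

Lemma yields_nonterminal ks X w : yields ks [:: inr X] w ->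
  exists k ks' r, [/\ ks = k :: ks', R k X r & yields ks' r w].
Proof.
move=> y; inversion y as [| |k ks' ? r ? w1 w2 Rr yr y']; subst.
by inversion y'; subst; rewrite cats0; exists k, ks', r.
Qed.

Lemma yields_rule k ks X r w :
  R k X r -> yields ks r w -> yields (k :: ks) [:: inr X] w.
Proof.
by move=> Rr yr; rewrite -[w]cats0; apply: YieldsNonterminal Rr yr (YieldsNil _).
Qed.

Variable b : nat.
Hypothesis R_size : forall k X u, R k X u -> size u <= b.
Hypothesis R_total : forall k X, exists u, R k X u.

(** Bounded right-hand sides over finite alphabets form a finite type, so any
    predicate on them is a legitimate table. *)
Definition rule_table (k : K) : table S V :=
  [fset (p.1, bseqval p.2)
    | p in [pred p : V * {bseq b of S + V} | `[< R k p.1 p.2 >]]]%fset.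

Lemma mem_rule_table k X u : (X, u) \in rule_table k <-> R k X u.
Proof.
split=> [/imfsetP[[Y v]] /= |Ru].
  by rewrite inE /= => Rv [-> ->].
rewrite /rule_table; apply/imfsetP; exists (X, Bseq (R_size Ru)) => //=.
by rewrite inE.
Qed.

Lemma yieldsE ks u w :
  yields ks u w <-> derives (map rule_table ks) u (map inl w).
Proof.
elim: ks u w => [|k ks IHks] u w /=; split.
- elim: u w => [|x u IHu] w y; first by inversion y.
  by inversion y as [|? a ? w' y'|]; subst; rewrite /= (IHu _ y').
- by move->; elim: w => [|a w IHw] /=; constructor.
- suff step ks' : yields ks' u w -> ks' = k :: ks ->
      exists2 u', rewrites (rule_table k) u u' & yields ks u' w.
    by move=> /step/(_ erefl)[u' ru /IHks]; exists u'.
  elim=> [?|? a ? ? _ IHu /IHu[u' ru yu]|? ? X r ? w1 w2 Rr yr _ _ IHu e].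
  + by exists [::]; constructor.
  + by exists (inl a :: u'); constructor.
  have [u' ru yu] := IHu e; case: e Rr yr => -> -> Rr yr.
  exists (r ++ u'); last exact: yields_cat.
  by constructor=> //; apply/mem_rule_table.
- case=> u1 ru /IHks.
  elim: ru w => {u u1} [w y|a u u1 _ IHu w y|X r u u1 /mem_rule_table Rr _ IHu w].
  + by inversion y; constructor.
  + by inversion y; subst; constructor; apply: IHu.
  case/yields_cat_inv=> w1 [w2 [-> y1 y2]].
  by apply: YieldsNonterminal Rr y1 (IHu _ y2).
Qed.

Lemma ET0L_rules (X0 : V) :
  ET0L [set w : seq S | exists ks, yields ks [:: inr X0] w]%classic.
Proof.
pose T : {fset table S V} := [fset rule_table k | k in [set: K]]%fset.
have T_total t : t \in T -> forall X, exists u, (X, u) \in t.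
  case/imfsetP=> k _ -> X; have [u Ru] := R_total k X.
  by exists u; apply/mem_rule_table.
have regT : regular [set: seq T]%classic.
  exists unit, tt, [set tt], (fun _ _ => tt); apply/seteqP; split=> // w _ /=.
  by rewrite inE; case: foldl.
exists (ET0LGrammar T_total regT X0); apply/seteqP; split=> w /=.
  case=> ks /yieldsE y; have memT k : rule_table k \in T.
    by apply/imfsetP; exists k; rewrite ?inE.
  exists [seq [` memT k]%fset | k <- ks] => //.
  by rewrite -map_comp; rewrite (eq_map (g := rule_table)).
case=> ts _ der; have [ks e] : exists ks, map val ts = map rule_table ks.
  elim: ts {der} => [|t ts [ks e]]; first by exists [::].
  by have /imfsetP[k _ ek] := valP t; exists (k :: ks); rewrite /= ek e.
by exists ks; apply/yieldsE; rewrite -e; apply: der.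
Qed.

End RuleFamilies.

(** * The path of a vertex through a word *)

Section Words.
Variables (d : nat) (A : finType) (aut : A -> tree_aut d).
Implicit Types (x : A) (w : seq A) (u : seq 'I_d).

Definition run w u : seq 'I_d := foldl (fun u x => aut x u) u w.

Fixpoint quiet w u : bool :=
  if w is x :: w' then (restr (aut x) u == 1%g) && quiet w' (aut x u) else true.

Lemma size_run w u : size (run w u) = size u.
Proof. by elim: w u => //= x w IHw u; rewrite IHw size_tree_aut. Qed.

Lemma prod_run w u : (\prod_(x <- w) aut x)%g u = run w u.
Proof. by elim: w u => [|x w IHw] u; rewrite ?big_nil ?big_cons //= -IHw. Qed.

Lemma run_cat w1 w2 u : run (w1 ++ w2) u = run w2 (run w1 u).
Proof. exact: foldl_cat. Qed.

Lemma quiet_cat w1 w2 u : quiet (w1 ++ w2) u = quiet w1 u && quiet w2 (run w1 u).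
Proof. by elim: w1 u => //= x w1 IHw u; rewrite IHw andbA. Qed.

Lemma quiet_run w u a : quiet w u -> run w (rcons u a) = rcons (run w u) a.
Proof.
elim: w u => //= x w IHw u /andP[/eqP x1 /IHw <-].
by rewrite tree_aut_rconsE x1.
Qed.

Lemma quiet_rcons w u a : quiet w u -> quiet w (rcons u a).
Proof.
elim: w u => //= x w IHw u /andP[/eqP x1 /IHw].
by rewrite restr_rcons tree_aut_rconsE x1 restr1_one eqxx.
Qed.

End Words.

(** * The grammar *)

Section Grammar.
Variables (d : nat) (A : finType) (aut : A -> tree_aut d).
Variables (Q : {fset tree_aut d}) (I : finType).
Implicit Types (x : A) (w : seq A) (u : seq 'I_d) (i j : I) (a b : 'I_d).

(** The description of a level below the root whose relevant vertices are named
    by I: the restrictions of the letters to them, the images of the vertices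
    under the letters, and the name of the parent together with the last
    letter. Images are meaningful for active letters only, since other images
    need not have a name. *)
Definition inner_level : finType :=
  ({ffun I -> {ffun A -> Q}} * {ffun A -> {ffun I -> I}} * {ffun I -> I * 'I_d})%type.

(** [None] describes the root level, where all names denote the root. *)
Local Notation level := (option inner_level).

Definition restr_at (t : level) i x : tree_aut d :=
  if t is Some s then val (s.1.1 i x) else aut x.

Definition image_at (t : level) x i : I :=
  if t is Some s then s.1.2 x i else i.

Definition parent (s : inner_level) i : I * 'I_d := s.2 i.

(** The wreath recursion links the descriptions s and t of consecutive levels.
    Images are compared through the names of their parents and their last
    letters, as these determine what a name of the lower level denotes, and only
    where a letter is active. *)
Definition child_level (s : inner_level) (t : level) : Prop :=
  (forall i x, restr_at (Some s) i x =
     restr1 (restr_at t (parent s i).1 x) (parent s i).2) /\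
  (forall i x, restr_at (Some s) i x != 1%g ->
     parent s (image_at (Some s) x i) = (image_at t x (parent s i).1,
       first_letter (restr_at t (parent s i).1 x) (parent s i).2)).

(** [Segment t i j] stands for a factor that carries vertex i to vertex j and is
    quiet there. [Walk t f (i, a) (j, b)] stands for a factor that carries the
    child a of vertex i to the child b of vertex j, and is quiet there unless f
    holds; it is in the course of being cut at the letters active at the level
    of t. The flag f is set for the whole word, which has not been cut at the
    level of the children. *)
Inductive nonterm : Type :=
| Start
| Dead
| Segment of level & I & I
| Walk of level & bool & I * 'I_d & I * 'I_d.

Definition nonterm_code X :
    option (option (level * I * I +
                    level * bool * (I * 'I_d) * (I * 'I_d))) :=
  match X with
  | Start => None
  | Dead => Some None
  | Segment t i j => Some (Some (inl (t, i, j)))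
  | Walk t f y z => Some (Some (inr (t, f, y, z)))
  end.

Definition nonterm_decode c : nonterm :=
  match c with
  | None => Start
  | Some None => Dead
  | Some (Some (inl (t, i, j))) => Segment t i j
  | Some (Some (inr (t, f, y, z))) => Walk t f y z
  end.

Lemma nonterm_codeK : cancel nonterm_code nonterm_decode.
Proof. by case. Qed.

HB.instance Definition _ := Finite.copy nonterm (can_type nonterm_codeK).

(** Table [None] works within a level and may be applied any number of times;
    the identity rule lets the walks of different lengths finish together.
    Table [Some t] moves the segments to the level described by t; for whatever
    is not ready to follow, in particular unfinished walks, it offers only
    [Dead], and it offers [Dead] to all others as well. *)
Inductive rule : option level -> nonterm -> seq (A + nonterm) -> Prop :=
| RuleIdle X : rule None X [:: inr X]
| RuleStart t i a b : a != b ->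
    rule None Start [:: inr (Walk t true (i, a) (i, b))]
| RuleStep t f i a j x z :
    restr_at t j x != 1%g -> f || (restr1 (restr_at t j x) a == 1%g) ->
    rule None (Walk t f (i, a) z)
      [:: inr (Segment t i j); inl x;
          inr (Walk t f (image_at t x j, first_letter (restr_at t j x) a) z)]
| RuleLast t f i j a : rule None (Walk t f (i, a) (j, a)) [:: inr (Segment t i j)]
| RuleRootStop i j : rule None (Segment None i j) [::]
(* The restriction of a letter to the root is the letter itself, so that only
   trivial letters are inactive there. *)
| RuleRootLetter i j x : aut x = 1%g ->
    rule None (Segment None i j) [:: inl x; inr (Segment None i j)]
| RuleAscend s t i j : child_level s t ->
    rule (Some t) (Segment (Some s) i j)
      [:: inr (Walk t false (parent s i) (parent s j))]
| RuleDead t X : rule (Some t) X [:: inr Dead].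

Lemma rule_size k X r : rule k X r -> size r <= 3.
Proof. by case. Qed.

Lemma rule_total k X : exists r, rule k X r.
Proof.
by case: k => [t|]; [exists [:: inr Dead] | exists [:: inr X]]; constructor.
Qed.

Definition faithful (t : level) (vertex : I -> seq 'I_d) : Prop :=
  (forall i x, restr_at t i x = restr (aut x) (vertex i)) /\
  (forall i x, restr_at t i x != 1%g ->
     vertex (image_at t x i) = aut x (vertex i)).

(** A sequence of tables determines what the names of the current level denote:
    the parents are named at the level that the next table [Some t'] moves to.
    Once the tables are used up, [::] is a default, which no successful
    derivation consults below the root. *)
Fixpoint vertex_of (ks : seq (option level)) (t : level) i : seq 'I_d :=
  match ks, t with
  | None :: ks', _ => vertex_of ks' t i
  | Some t' :: ks', Some s =>
      rcons (vertex_of ks' t' (parent s i).1) (parent s i).2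
  | _, _ => [::]
  end.

Definition meaning (ks : seq (option level)) (X : nonterm) w : Prop :=
  match X with
  | Start => (\prod_(x <- w) aut x)%g != 1%g
  | Dead => False
  | Segment t i j =>
      [/\ faithful t (vertex_of ks t), quiet aut w (vertex_of ks t i)
        & run aut w (vertex_of ks t i) = vertex_of ks t j]
  | Walk t f (i, a) (j, b) =>
      [/\ faithful t (vertex_of ks t), f || quiet aut w (rcons (vertex_of ks t i) a)
        & run aut w (rcons (vertex_of ks t i) a) = rcons (vertex_of ks t j) b]
  end.

Lemma vertex_of_root ks i : vertex_of ks None i = [::].
Proof. by elim: ks => [|[]]. Qed.

Lemma faithful_root ks : faithful None (vertex_of ks None).
Proof. by split=> *; rewrite !vertex_of_root //= tree_aut_root. Qed.

(** A letter active at a child is active at its parent, so the images that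
    matter for s are among those that t describes truly. *)
Lemma faithful_child s t v : child_level s t -> faithful t v ->
  faithful (Some s) (fun i => rcons (v (parent s i).1) (parent s i).2).
Proof.
move=> [sr si] [tr ti]; split=> i x; first by rewrite sr tr restr_rcons.
move=> nz; rewrite si //= tree_aut_rconsE -tr ti //.
by apply: contraNneq nz => t1; rewrite sr t1 restr1_one.
Qed.

(** Descriptions are guessed while ascending but can be trusted only from the
    root down, so faithfulness is part of the conclusion: a segment can
    disappear only at the root, hence each successful derivation certifies the
    whole chain of descriptions above it. *)
Lemma yields_meaning ks X w : yields rule ks [:: inr X] w -> meaning ks X w.
Proof.
elim: ks X w => [|k ks IHks] X w /yields_nonterminal[k' [ks' [r [//]]]].
move=> [<- <-] kr; case: kr IHks => {k k' ks' X r}.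
- by move=> X IH /IH.
- move=> t i a b ab IH /IH[_ _ wab] /=.
  apply: contraNneq ab => w1; move: wab; rewrite -prod_run w1.
  by move/rcons_inj => [->].
- move=> t f i a j x [m b] nz fz IH /=.
  move=> /(@yields_cat_inv _ _ _ _ _ [:: _])[w1 [w2 [-> /IH[ft q1 r1] y2]]].
  inversion y2 as [|? ? ? w3 y3|]; subst; have [_ q3 r3] := IH _ _ y3.
  have [tr ti] := ft.
  have e : aut x (rcons (vertex_of ks t j) a) =
      rcons (vertex_of ks t (image_at t x j)) (first_letter (restr_at t j x) a).
    by rewrite tree_aut_rconsE -tr ti.
  split=> //; last by rewrite run_cat /= quiet_run // r1 e.
  rewrite quiet_cat quiet_rcons //= quiet_run // r1 e restr_rcons -tr.
  by case: f fz q3 {y2 y3} => //= -> ->.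
- move=> t f i j a IH /IH[ft q r] /=; split=> //.
    by rewrite quiet_rcons ?orbT.
  by rewrite quiet_run // r.
- move=> i j IH y; inversion y; subst; split=> //=; first exact: faithful_root.
  by rewrite !vertex_of_root.
- move=> i j x x1 IH y; inversion y as [|? ? ? w' y'|]; subst.
  have [_ q r] := IH _ _ y'; split=> /=; first exact: faithful_root.
    by move: q; rewrite !vertex_of_root /= tree_aut_root x1 eqxx.
  by move: r; rewrite !vertex_of_root /= tree_aut_root.
- move=> s t i j st IH /IH /=.
  case pi : (parent s i) => [i' a]; case pj : (parent s j) => [j' b] [ft /= q r].
  by split; rewrite ?pi ?pj //; exact: (faithful_child st ft).
- by move=> t X IH /IH.
Qed.

(** From here on the names come from an actual set of vertices, closed under
    parents and containing the vertices where letters are active together with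
    their images. [vertex] names only such vertices, and every one of them. *)
Hypothesis Q_restr : forall x u, restr (aut x) u \in Q.
Variables (named : pred (seq 'I_d)) (a0 : 'I_d).
Hypothesis named_parent : forall u a, named (rcons u a) -> named u.
Hypothesis named_active :
  forall x u, restr (aut x) u != 1%g -> named u /\ named (aut x u).
Variables (vertex : nat -> I -> seq 'I_d) (name : seq 'I_d -> I).
Hypothesis vertex_named : forall k i, named (vertex k i).
Hypothesis size_vertex : forall k i, size (vertex k i) = k.
Hypothesis nameK : forall u, named u -> vertex (size u) (name u) = u.

Definition inner_level_at k : inner_level :=
  ([ffun i => [ffun x => [` Q_restr x (vertex k i)]%fset]],
   [ffun x => [ffun i => name (aut x (vertex k i))]],
   [ffun i => (name (take k.-1 (vertex k i)), last a0 (vertex k i))]).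

Definition level_at k : level := if k is 0 then None else Some (inner_level_at k).

Lemma restr_level_at k i x : restr_at (level_at k) i x = restr (aut x) (vertex k i).
Proof.
case: k => [|k]; last by rewrite /= !ffunE.
by rewrite (size0nil (size_vertex 0 i)).
Qed.

Lemma image_level_at x u : named u -> named (aut x u) ->
  image_at (level_at (size u)) x (name u) = name (aut x u).
Proof.
case: u => [|a u] nu nxu /=; first by rewrite tree_aut_root.
by rewrite !ffunE (nameK nu).
Qed.

Lemma parent_inner_level_at k u a : size u = k -> named (rcons u a) ->
  parent (inner_level_at k.+1) (name (rcons u a)) = (name u, a).
Proof.
move=> <- nu; rewrite /parent ffunE.
have := nameK nu; rewrite size_rcons => ->.
by rewrite last_rcons -cats1 take_size_cat.
Qed.

Lemma inner_level_at_child k : child_level (inner_level_at k.+1) (level_at k).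
Proof.
have vE i : exists u a, [/\ vertex k.+1 i = rcons u a, named u, size u = k
    & parent (inner_level_at k.+1) i = (name u, a)].
  have := vertex_named k.+1 i; have := size_vertex k.+1 i.
  case/lastP vi: (vertex k.+1 i) => [|u a] //; rewrite size_rcons => -[su] nu.
  exists u, a; split=> //; first exact: named_parent nu.
  by rewrite /parent ffunE vi last_rcons -cats1 take_size_cat.
split=> i x; rewrite (restr_level_at k.+1); have [u [a [vi nu su pi]]] := vE i.
  by rewrite vi pi restr_level_at -su nameK // restr_rcons.
rewrite vi pi restr_level_at /= !ffunE vi -su nameK // => nz.
have [_ nxua] := named_active nz; rewrite tree_aut_rconsE in nxua *.
rewrite image_level_at //; last exact: named_parent nxua.
by rewrite parent_inner_level_at ?size_tree_aut.
Qed.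

Lemma quiet_split w u : ~~ quiet aut w u ->
  exists w1 x w2, [/\ w = w1 ++ x :: w2, quiet aut w1 u
    & restr (aut x) (run aut w1 u) != 1%g].
Proof.
elim: w u => //= x w IHw u; have [x1|nz _] := eqVneq (restr (aut x) u) 1%g.
  by case/IHw=> w1 [y [w2 [-> q nz]]]; exists (x :: w1), y, w2; rewrite /= x1 eqxx.
by exists [::], x, w.
Qed.

Lemma yields_idle n ks X w :
  yields rule ks [:: inr X] w -> yields rule (nseq n None ++ ks) [:: inr X] w.
Proof. by move=> y; elim: n => //= n IHn; apply: yields_rule IHn; constructor. Qed.

(** Cutting w at its letters active at level k takes one application of the
    working table for each cut and one for the last factor, so n applications
    are enough for any word shorter than n. The bound m on the factors is kept
    apart from n, which decreases along the induction. *)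
Lemma yields_walk m ks f k :
    (forall w u v, size w <= m -> named u -> named v -> size u = k ->
      quiet aut w u -> run aut w u = v ->
      yields rule ks [:: inr (Segment (level_at k) (name u) (name v))] w) ->
  forall n w u v a b, size w < n -> size w <= m -> named u -> named v ->
    size u = k -> f || quiet aut w (rcons u a) ->
    run aut w (rcons u a) = rcons v b ->
  yields rule (nseq n None ++ ks)
    [:: inr (Walk (level_at k) f (name u, a) (name v, b))] w.
Proof.
move=> seg; elim=> // n IHn w u v a b wn wm nu nv su fq ruv.
have [q|/quiet_split[w1 [x [w2 [wE q nz]]]]] := boolP (quiet aut w u).
  move: ruv; rewrite quiet_run // => /rcons_inj[rw <-] /=.
  by apply: yields_rule (RuleLast _ _ _ _ _) _; apply/yields_idle/seg.
have [n1 n2] := named_active nz.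
have s1 : size (run aut w1 u) = k by rewrite size_run.
have rE : restr_at (level_at k) (name (run aut w1 u)) x = restr (aut x) (run aut w1 u).
  by rewrite restr_level_at -{1}s1 nameK.
subst w; move: wn wm fq ruv; rewrite size_cat /= addnS ltnS => wn wm.
rewrite quiet_cat run_cat /= quiet_run // restr_rcons tree_aut_rconsE => fq ruv.
apply: (@yields_rule _ _ _ _ None _ _
          [:: inr _; inl x; inr (Walk _ _ (name (aut x (run aut w1 u)), _) _)]).
  rewrite -image_level_at // s1; apply: RuleStep; rewrite rE //.
  by case: f fq {IHn} => //= /and3P[].
rewrite -/(nseq _ _ ++ _) -cat1s; apply: yields_cat.
  by apply/yields_idle/seg => //; apply: leq_trans (leq_addr _ _) (ltnW wm).
constructor; rewrite rE; apply: IHn => //.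
- exact: leq_ltn_trans (leq_addl _ _) wn.
- exact: leq_trans (leq_addl _ _) (ltnW wm).
- by rewrite size_tree_aut.
by case: f fq => //= /and3P[].
Qed.

(** The number n of working steps is the same at all levels, so that one
    sequence of tables serves all the segments, whatever their lengths. *)
Fixpoint schedule n k : seq (option level) :=
  if k is k'.+1 then Some (level_at k') :: nseq n None ++ schedule n k'
  else nseq n None.

Lemma yields_root n i j w : size w < n -> quiet aut w [::] ->
  yields rule (nseq n None) [:: inr (Segment None i j)] w.
Proof.
elim: n w => // n IHn [|x w] /= wn.
  by move=> _; apply: yields_rule (RuleRootStop _ _) _; constructor.
rewrite tree_aut_root => /andP[/eqP x1 q].
apply: yields_rule (RuleRootLetter _ _ x1) _.
by constructor; apply: IHn.
Qed.

Lemma yields_schedule n k w u v : size w < n -> named u -> named v ->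
  size u = k -> quiet aut w u -> run aut w u = v ->
  yields rule (schedule n k) [:: inr (Segment (level_at k) (name u) (name v))] w.
Proof.
elim: k w u v => [|k IHk] w u v wn nu nv su q r.
  by move/size0nil: su q r => -> q r; apply: yields_root.
move: su; case/lastP: u => [|u a] // in nu q r *; rewrite size_rcons => -[su].
have sv : size v = k.+1 by rewrite -r size_run size_rcons su.
move: sv; case/lastP: v => [|v b] // in nv r *; rewrite size_rcons => -[sv].
apply: yields_rule (RuleAscend _ _ (inner_level_at_child k)) _.
rewrite !parent_inner_level_at //.
apply: (yields_walk (m := n.-1)) => //.
- by move=> w' u' v' wn' nu' nv' su' q' r'; apply: IHk => //; case: (n) wn wn'.
- by case: (n) wn.
- exact: named_parent nu.
- exact: named_parent nv.
Qed.

Lemma yields_start w u a b : named u -> run aut w u = u ->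
  run aut w (rcons u a) = rcons u b -> a != b ->
  exists ks, yields rule ks [:: inr Start] w.
Proof.
move=> nu ru rab ab; pose n := (size w).+1.
exists (None :: nseq n None ++ schedule n (size u)).
apply: yields_rule (RuleStart (level_at (size u)) (name u) ab) _.
apply: (yields_walk (m := size w)) => // w' u' v' ww' *.
exact: yields_schedule.
Qed.

End Grammar.

(** * The coword problem *)

Lemma card_bigcup_le (T J : finType) (F : J -> {set T}) :
  #|\bigcup_j F j| <= \sum_j #|F j|.
Proof.
elim/big_rec2: _ => [|j n S _ Sn]; first by rewrite cards0.
by rewrite (leq_trans (leq_card_setU _ _).1) // leq_add2l.
Qed.

Lemma small_set_names (T : finType) (S : {set T}) n : 0 < #|S| <= n.+1 ->
  exists (vertex : 'I_n.+1 -> T) (name : T -> 'I_n.+1),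
    (forall i, vertex i \in S) /\ (forall y, y \in S -> vertex (name y) = y).
Proof.
case/andP=> /card_gt0P[y0 Sy0] leSn.
exists (fun i => nth y0 (enum S) i), (fun y => inord (index y (enum S))); split.
  move=> i; have [iS|Si] := ltnP i (size (enum S)); last by rewrite nth_default.
  by rewrite -(mem_enum S) mem_nth.
move=> y; rewrite -(mem_enum S) => Sy; rewrite inordK ?nth_index //.
by apply: leq_trans leSn; rewrite cardE index_mem.
Qed.

Section CowordGrammar.
Variables (d : nat) (A : finType) (aut : A -> tree_aut d).
Hypothesis aut_inv : forall x, exists y, aut y = ((aut x)^-1)%g.

Lemma restr_finite_union : (forall x, automaton_aut (aut x)) ->
  exists Q : {fset tree_aut d}, forall x u, restr (aut x) u \in Q.
Proof.
move=> autoA; have /choice[Qx QxP] x := automaton_restr_finite (autoA x).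
exists (\bigcup_(x <- enum A) Qx x)%fset => x u.
by apply/bigfcupP; exists x; rewrite ?mem_enum.
Qed.

Lemma active_bounded : (forall x, bounded_aut (aut x)) ->
  exists N, forall k,
    #|\bigcup_x [set v : k.-tuple 'I_d | restr (aut x) v != 1%g]| <= N.
Proof.
case/choice=> Nx NxP; exists (\sum_x Nx x) => k.
exact: leq_trans (card_bigcup_le _) (leq_sum _ (fun x _ => NxP x k)).
Qed.

(** The named vertices are those at which some letter is active and those on the
    path to the fixed vertex u, prolonged arbitrarily so that every level has
    one: at most N + 1 in each level. *)
Lemma coword_yields (Q : {fset tree_aut d}) N :
    (forall x u, restr (aut x) u \in Q) ->
    (forall k, #|\bigcup_x [set v : k.-tuple 'I_d | restr (aut x) v != 1%g]| <= N) ->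
  forall w, (\prod_(x <- w) aut x)%g != 1%g ->
  exists ks, yields (rule aut (Q := Q) (I := 'I_N.+1)) ks [:: inr (Start _ _ _)] w.
Proof.
move=> Q_restr activeN w /moved_child[u [a [b [fix_u move_ua ab]]]].
pose path n := nth a u n.
pose named v := (v == mkseq path (size v)) || [exists x, restr (aut x) v != 1%g].
have named_parent v c : named (rcons v c) -> named v.
  case/orP=> [|/existsP[x nz]].
    rewrite size_rcons mkseqS eqseq_rcons => /andP[ev _].
    by rewrite /named ev.
  apply/orP; right; apply/existsP; exists x.
  by apply: contraNneq nz => x1; rewrite restr_rcons x1 restr1_one.
have named_active x v : restr (aut x) v != 1%g -> named v /\ named (aut x v).
  move=> nz; have [y yE] := aut_inv x; split; apply/orP; right; apply/existsP.
    by exists x.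
  exists y; rewrite yE; apply: contra_neq nz; exact: restr_inv_eq1.
pose S k := [set v : k.-tuple 'I_d | named v].
have names k : {vertex : 'I_N.+1 -> k.-tuple 'I_d &
    {name : k.-tuple 'I_d -> 'I_N.+1 |
    (forall i, vertex i \in S k) /\ (forall v, v \in S k -> vertex (name v) = v)}}.
  pose v0 : k.-tuple 'I_d := Tuple (introT eqP (size_mkseq path k)).
  suff /small_set_names/cid[vertex /cid namesP] : 0 < #|S k| <= N.+1.
    by exists vertex.
  apply/andP; split.
    by apply/card_gt0P; exists v0; rewrite inE /named /= size_mkseq eqxx.
  apply: leq_trans (_ : #|[set v0] :|: \bigcup_x
      [set v : k.-tuple 'I_d | restr (aut x) v != 1%g]| <= _).
    apply/subset_leq_card/fintype.subsetP => v; rewrite !inE => /orP[/eqP ev|].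
      by apply/orP; left; apply/eqP/val_inj; rewrite /= ev size_tuple.
    case/existsP=> x nz; apply/orP; right.
    by apply/bigcupP; exists x; rewrite ?inE.
  by rewrite (leq_trans (leq_card_setU _ _).1) // cards1 add1n ltnS activeN.
apply: (@yields_start _ _ _ Q _ Q_restr named a named_parent named_active
    (fun k i => projT1 (names k) i)
    (fun v => sval (projT2 (names (size v))) (in_tuple v)) _ _ _ w u a b) => //.
- move=> k i; case: (names k) => vertex [name [vertexS _]] /=.
  by have := vertexS i; rewrite inE.
- by move=> k i; rewrite size_tuple.
- move=> v nv; case: (names (size v)) => vertex [name [_ nameK]] /=.
  by rewrite nameK ?inE.
- apply/orP; left; apply/eqP/(@eq_from_nth _ a); rewrite ?size_mkseq // => i iu.
  by rewrite nth_mkseq.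
- by rewrite -prod_run.
- by rewrite -prod_run.
Qed.

Lemma coword_ET0L : (forall x, bounded_automaton_aut (aut x)) ->
  ET0L [set w : seq A | (\prod_(x <- w) aut x)%g != 1%g]%classic.
Proof.
move=> bA.
have [Q Q_restr] := restr_finite_union (fun x => (bA x).1).
have [N activeN] := active_bounded (fun x => (bA x).2).
have := ET0L_rules (@rule_size _ _ aut Q 'I_N.+1) (@rule_total _ _ aut Q 'I_N.+1)
  (Start _ _ _).
congr ET0L; apply/seteqP; split=> w /=; last exact: coword_yields.
by case=> ks /yields_meaning.
Qed.

End CowordGrammar.

Local Open Scope classical_set_scope.

Theorem theorem1 (d : nat) (hd : (2 <= d)%N) (G : set (tree_aut d))
    (G_subgroup : group_closed (mem G))
    (G_bounded_automata : G `<=` @bounded_automaton_aut d)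
    (G_fg : finitely_generated G) :
  co_ET0L G.
Proof.
have [X genX] := G_fg; exists X => //.
apply: (@coword_ET0L d (letters X) val) => x.
  suff xV : ((val x)^-1)%g \in letters X by exists [` xV]%fset.
  rewrite /letters; have := valP x.
  rewrite !inE => /orP[xX|/imfsetP[y yX ->]]; apply/orP; [right|left].
    by apply/imfsetP; exists (val x).
  by rewrite invgK.
apply: G_bounded_automata; rewrite genX; exists [:: x].
by rewrite /word_value big_seq1.
Qed.
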